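(* Let $a_n$ be the number of inversion sequences $e\in\mathbf{I}_n$ for which there are no indices $i<j<k$ with $e_i>e_j$ and $e_j\le e_k$ (with $a_0=1$). Then $$\sum_{n\ge0}a_nz^n=\frac{1+2z-\sqrt{1-4z-4z^2}}{4z}.$$
   Context: An inversion sequence of length $n$ is an integer sequence $e=e_1\dots e_n$ with $0\le e_i<i$ for all $i$; $\mathbf{I}_n$ is the set of these, and $\mathbf{I}_0$ consists of the empty sequence. In the paper's notation $a_n=|\mathbf{I}_n(>,\leq,-)|$. *)

(* Defs.v *)
From HB Require Import structures.
From mathcomp Require Import all_boot all_order all_algebra.
From mathcomp Require Import boolp.

Set Implicit Arguments.
Unset Strict Implicit.
Unset Printing Implicit Defensive.

Import Order.TTheory GRing.Theory Num.Theory.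
Local Open Scope ring_scope.

(* Positions are numbered from 0 here: position i : 'I_n is the i.+1-th entry
   of the sequence, so that the bound e_(i+1) < i+1 reads e i <= i.  All
   entries are < n, hence the codomain 'I_n; for n = 0 the only function is
   the empty sequence. *)
Definition inversion_seqs (n : nat) : {set {ffun 'I_n -> 'I_n}} :=
  [set e : {ffun 'I_n -> 'I_n} | [forall i : 'I_n, (e i <= i)%N]].

Definition has_pattern (n : nat) (e : {ffun 'I_n -> 'I_n}) : bool :=
  [exists i : 'I_n, exists j : 'I_n, exists k : 'I_n,
    [&& (i < j)%N, (j < k)%N, (e j < e i)%N & (e j <= e k)%N]].

Definition avoiders (n : nat) : {set {ffun 'I_n -> 'I_n}} :=
  [set e in inversion_seqs n | ~~ has_pattern e].

Definition a (n : nat) : nat := #|avoiders n|.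

Lemma a0 : a 0 = 1%N.
Proof.
rewrite /a; have -> : avoiders 0 = setT.
  apply/setP => e; rewrite !inE; apply/andP; split.
    by apply/forallP => -[].
  by apply/existsP => -[[]].
by rewrite cardsT card_ffun card_ord.
Qed.

(* Formal power series: coef f n is the coefficient of z^n. *)
Record fps (K : fieldType) := Fps { coef : nat -> K }.

Section FormalPowerSeries.
Variable K : fieldType.
Implicit Types f g h : fps K.

Lemma fpsP f g : (forall n, coef f n = coef g n) -> f = g.
Proof. by case: f g => [f] [g] /= /funext ->. Qed.

HB.instance Definition _ := gen_eqMixin (fps K).
HB.instance Definition _ := gen_choiceMixin (fps K).

Definition fps_zero : fps K := Fps (fun _ => 0).
Definition fps_opp f : fps K := Fps (fun n => - coef f n).
Definition fps_add f g : fps K := Fps (fun n => coef f n + coef g n).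
Definition fps_one : fps K := Fps (fun n => (n == 0)%:R).
Definition fps_mul f g : fps K :=
  Fps (fun n => \sum_(i < n.+1) coef f i * coef g (n - i)).

Fact fps_addA : associative fps_add.
Proof. by move=> f g h; apply: fpsP => n /=; rewrite addrA. Qed.
Fact fps_addC : commutative fps_add.
Proof. by move=> f g; apply: fpsP => n /=; rewrite addrC. Qed.
Fact fps_add0 : left_id fps_zero fps_add.
Proof. by move=> f; apply: fpsP => n /=; rewrite add0r. Qed.
Fact fps_addN : left_inverse fps_zero fps_opp fps_add.
Proof. by move=> f; apply: fpsP => n /=; rewrite addNr. Qed.

HB.instance Definition _ :=
  GRing.isZmodule.Build (fps K) fps_addA fps_addC fps_add0 fps_addN.

Definition trunc (m : nat) f : {poly K} := \poly_(i < m) coef f i.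

Fact coef_mul_trunc (m n : nat) f g (p q : {poly K}) : (n < m)%N ->
  (forall i, (i < m)%N -> p`_i = coef f i) ->
  (forall i, (i < m)%N -> q`_i = coef g i) ->
  (p * q)`_n = coef (fps_mul f g) n.
Proof.
move=> nm pf qg; rewrite coefM; apply: eq_bigr => i _.
rewrite pf ?qg //; first exact: leq_ltn_trans (leq_subr _ _) nm.
exact: leq_trans (ltn_ord i) nm.
Qed.

Fact coef_trunc (m i : nat) f : (i < m)%N -> (trunc m f)`_i = coef f i.
Proof. by move=> im; rewrite coef_poly im. Qed.

Fact fps_mulA : associative fps_mul.
Proof.
move=> f g h; apply: fpsP => n.
pose T := trunc n.+1.
have ET k i : (i < n.+1)%N -> (T k)`_i = coef k i by exact: coef_trunc.
rewrite -(@coef_mul_trunc n.+1 n _ _ (T f) (T g * T h)) //; last 2 first.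
- exact: ET.
- by move=> i im; apply: (@coef_mul_trunc n.+1) => // j; apply: ET.
rewrite -(@coef_mul_trunc n.+1 n _ _ (T f * T g) (T h)) //; last 2 first.
- by move=> i im; apply: (@coef_mul_trunc n.+1) => // j; apply: ET.
- exact: ET.
by rewrite mulrA.
Qed.

Fact fps_mulC : commutative fps_mul.
Proof.
move=> f g; apply: fpsP => n.
have ET k i : (i < n.+1)%N -> (trunc n.+1 k)`_i = coef k i
  by exact: coef_trunc.
rewrite -(@coef_mul_trunc n.+1 n f g _ _ _ (ET f) (ET g)) // mulrC.
exact: (@coef_mul_trunc n.+1 n g f _ _ _ (ET g) (ET f)).
Qed.

Fact fps_mul1 : left_id fps_one fps_mul.
Proof.
move=> f; apply: fpsP => n /=.
rewrite big_ord_recl /= mul1r subn0 big1 ?addr0 // => i _.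
by rewrite mul0r.
Qed.

Fact fps_mulDl : left_distributive fps_mul fps_add.
Proof.
move=> f g h; apply: fpsP => n /=.
by rewrite -big_split /=; apply: eq_bigr => i _; rewrite mulrDl.
Qed.

Fact fps_one_neq0 : fps_one != fps_zero.
Proof.
apply/eqP => /(congr1 (fun f => coef f 0)) /= /eqP.
by rewrite oner_eq0.
Qed.

HB.instance Definition _ := GRing.Zmodule_isComNzRing.Build (fps K)
  fps_mulA fps_mulC fps_mul1 fps_mulDl fps_one_neq0.

Definition fps_unit : {pred fps K} := fun f => `[< exists g, g * f = 1 >].
Definition fps_inv f : fps K :=
  if pselect (exists g, g * f = 1) is left fV then projT1 (cid fV) else f.

Fact fps_mulV : {in fps_unit, left_inverse 1 fps_inv *%R}.
Proof.
move=> f /asboolP fV; rewrite /fps_inv; case: pselect => // fV'.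
exact: (projT2 (cid fV')).
Qed.
Fact fps_unitPl f g : g * f = 1 -> fps_unit f.
Proof. by move=> gf; apply/asboolP; exists g. Qed.
Fact fps_inv_out : {in [predC fps_unit], fps_inv =1 id}.
Proof.
by move=> f /asboolPn fN; rewrite /fps_inv; case: pselect.
Qed.

HB.instance Definition _ := GRing.ComNzRing_hasMulInverse.Build (fps K)
  fps_mulV fps_unitPl fps_inv_out.

Fact fps_neq0 f : f != 0 ->
  exists2 m, coef f m != 0 & forall i, (i < m)%N -> coef f i = 0.
Proof.
move=> f0; have [n fn] : exists n, coef f n != 0.
  apply: contrapT => fN; case/eqP: f0; apply: fpsP => n.
  by apply/eqP; apply: contrapT => /negP fn; apply: fN; exists n.
have exf : exists n, coef f n != 0 by exists n.
exists (ex_minn exf); first by case: ex_minnP.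
case: ex_minnP => m _ mmin i im; apply/eqP; apply: contraTT im => fi.
by rewrite -leqNgt mmin.
Qed.

Fact fps_mulf_eq0 : GRing.integral_domain_axiom (fps K).
Proof.
move=> f g fg; apply: contrapT => /negP; rewrite negb_or => /andP[].
move=> /fps_neq0[m fm fi] /fps_neq0[p gp gi].
have := congr1 (fun h => coef h (m + p)) fg.
have mi : (m < (m + p).+1)%N by rewrite ltnS leq_addr.
rewrite /= (bigD1 (Ordinal mi)) //= addKn big1 ?addr0 => [/eqP|i im].
  by rewrite mulf_eq0 (negPf fm) (negPf gp).
case: (ltngtP i m) => [lt_im|lt_mi|eq_im].
- by rewrite fi // mul0r.
- by rewrite gi ?mulr0 // ltn_subLR ?ltn_add2r // -ltnS ltn_ord.
- by case/eqP: im; apply: val_inj.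
Qed.

HB.instance Definition _ :=
  GRing.ComUnitRing_isIntegral.Build (fps K) fps_mulf_eq0.

Definition fpsX : fps K := Fps (fun n => (n == 1%N)%:R).

(* The coefficients s_0, ..., s_n of the square root of f: s_0 = 1, and s_m
   (m > 0) is obtained by comparing the coefficients of z^m in s^2 = f. *)
Fixpoint sqrt_coefs f (n : nat) : seq K :=
  if n is m.+1 then
    let s := sqrt_coefs f m in
    rcons s ((coef f n - \sum_(1 <= i < n) s`_i * s`_(n - i)) / 2)
  else [:: 1].

(* The square root with constant term 1 of a series with constant term 1,
   see fps_sqrtP; the value is irrelevant for other series. *)
Definition fps_sqrt f : fps K := Fps (fun n => (sqrt_coefs f n)`_n).

Fact size_sqrt_coefs f n : size (sqrt_coefs f n) = n.+1.
Proof. by elim: n => //= n IHn; rewrite size_rcons IHn. Qed.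

Fact nth_sqrt_coefs f n i : (i <= n)%N ->
  (sqrt_coefs f n)`_i = coef (fps_sqrt f) i.
Proof.
elim: n => [|n IHn]; first by rewrite leqn0 => /eqP->.
rewrite leq_eqVlt ltnS => /orP[/eqP-> //|le_in].
by rewrite /= nth_rcons size_sqrt_coefs ltnS le_in IHn.
Qed.

Lemma fps_sqrt0 f : coef (fps_sqrt f) 0 = 1.
Proof. by []. Qed.

Lemma fps_sqrtS f n : coef (fps_sqrt f) n.+1 =
  (coef f n.+1 - \sum_(1 <= i < n.+1)
     coef (fps_sqrt f) i * coef (fps_sqrt f) (n.+1 - i)) / 2.
Proof.
rewrite {1}/fps_sqrt /= nth_rcons size_sqrt_coefs ltnn eqxx.
congr ((_ - _) / 2); rewrite big_nat_cond [RHS]big_nat_cond.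
apply: eq_bigr => i /andP[/andP[i0 ltin] _].
by rewrite !nth_sqrt_coefs // leq_subLR -add1n leq_add.
Qed.

Fact coef_sqrS f n : coef (f ^+ 2) n.+1 =
  coef f 0 * coef f n.+1 *+ 2 +
  \sum_(1 <= i < n.+1) coef f i * coef f (n.+1 - i).
Proof.
rewrite expr2 /=.
rewrite -(big_mkord xpredT (fun i => coef f i * coef f (n.+1 - i))).
rewrite big_nat_recl // big_nat_recr //= subn0 subnn [_ * coef f 0]mulrC.
by rewrite addrCA mulr2n big_add1 /= [RHS]addrC.
Qed.

Lemma fps_sqrtP f g : 2 != 0 :> K -> coef f 0 = 1 ->
  (g = fps_sqrt f) <-> (g ^+ 2 = f /\ coef g 0 = 1).
Proof.
move=> two f0; split=> [->|[<- g0]].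
  split=> //; apply: fpsP => -[|n].
    by rewrite expr2 /= big_ord1 /= mul1r f0.
  by rewrite coef_sqrS fps_sqrt0 mul1r fps_sqrtS -mulr_natr divfK // subrK.
apply: fpsP => n; elim/ltn_ind: n => -[|n] IHn; first by rewrite g0.
rewrite fps_sqrtS coef_sqrS g0 mul1r.
suff -> : \sum_(1 <= i < n.+1)
    coef (fps_sqrt (g ^+ 2)) i * coef (fps_sqrt (g ^+ 2)) (n.+1 - i) =
  \sum_(1 <= i < n.+1) coef g i * coef g (n.+1 - i).
  by rewrite addrK -mulr_natr mulfK.
rewrite big_nat_cond [RHS]big_nat_cond.
apply: eq_bigr => i /andP[/andP[i0 ltin] _].
by rewrite !IHn // ltn_subrL i0.
Qed.

End FormalPowerSeries.

(* Main.v *)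
(** An avoider is a weakly increasing sequence followed by a strictly decreasing
    one.  Build it from left to right: in the weakly increasing phase, with last
    entry m and s admissible values m, ..., m+s-1 for the next entry, let H(s,m)
    be the generating function of the ways to continue.  The next entry x either
    prolongs this phase or the rest is a strictly decreasing list of entries
    below m, so H(s,m) = (1+z)^m + z \sum_(m <= x < m+s) H(m+s+1-x, x).  If
    T = 1 + z + z T^2, this is solved by 2 H(s,m) = (1+z)^m (1 + T^s), and the
    generating function of the avoiders is H(1,0) = (1+T)/2. *)
Require Import Defs.
From HB Require Import structures.
From mathcomp Require Import all_boot all_order all_algebra.
From mathcomp Require Import zify ring.

Import GRing.Theory.
Local Open Scope ring_scope.

Set Implicit Arguments.
Unset Strict Implicit.
Unset Printing Implicit Defensive.

(** * Duplicate-free enumeration of the possible continuations *)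

Section Lists.
Local Open Scope nat_scope.

(** Splitting on whether the head is the largest allowed entry mirrors Pascal's rule. *)
Fixpoint decreasing_lists (m r : nat) : seq (seq nat) :=
  match r, m with
  | 0, _ => [:: [::]]
  | _.+1, 0 => [::]
  | r'.+1, m'.+1 =>
      [seq m' :: l | l <- decreasing_lists m' r'] ++ decreasing_lists m' r
  end.

Lemma size_decreasing_lists m r : size (decreasing_lists m r) = 'C(m, r).
Proof.
elim: m r => [|m IHm] [|r] //=.
by rewrite size_cat size_map !IHm binS addnC.
Qed.

Lemma mem_cons_map (T : eqType) (x y : T) (w : seq T) (s : seq (seq T)) :
  (x :: w \in [seq y :: l | l <- s]) = (x == y) && (w \in s).
Proof.
apply/mapP/andP => [[l ls [-> ->]]|[/eqP-> ws]]; first by rewrite eqxx.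
by exists w.
Qed.

Lemma mem_decreasing_lists m r w :
  (w \in decreasing_lists m r) = (size w == r) && path gtn m w.
Proof.
elim: m r w => [|m IHm] [|r] [|x w] //=; first by rewrite andbF.
  by rewrite mem_cat IHm orbF; apply/mapP => -[].
rewrite mem_cat mem_cons_map !IHm /= eqSS ltnS.
by case: (ltngtP x m) => [xm|xm|->]; rewrite /= ?andbF ?orbF.
Qed.

Lemma uniq_decreasing_lists m r : uniq (decreasing_lists m r).
Proof.
elim: m r => [|m IHm] [|r] //=.
rewrite cat_uniq map_inj_uniq => [|l l' [] //]; rewrite !IHm andbT /=.
apply/hasPn => -[|x w]; rewrite mem_decreasing_lists //= => /and3P[_ xm _].
by rewrite mem_cons_map (ltn_eqF xm).
Qed.

(** After i entries the next one is at most i, so m + s = i + 1 throughout; the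
    empty sequence is treated as s = 1, m = 0. *)
Fixpoint continuations (r s m : nat) : seq (seq nat) :=
  if r is r'.+1 then
    [seq x :: l | x <- iota m s, l <- continuations r' (m + s.+1 - x) x]
      ++ decreasing_lists m r
  else [:: [::]].

Fixpoint continues (s m : nat) (w : seq nat) : bool :=
  if w is x :: w' then
    (m <= x < m + s) && continues (m + s.+1 - x) x w' || path gtn m w
  else true.

Lemma mem_continuations r s m w :
  (w \in continuations r s m) = (size w == r) && continues s m w.
Proof.
elim: r s m w => [|r IHr] s m [|x w] //=; rewrite mem_cat mem_decreasing_lists.
  by rewrite orbF; apply/allpairsPdep => -[? [? []]].
rewrite /= eqSS andb_orr; congr (_ || _).
apply/allpairsPdep/and3P => [[y [l [ys lL [-> ->]]]]|[wr xs wL]].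
  by move: lL; rewrite IHr => /andP[-> ->]; rewrite -mem_iota ys.
by exists x, w; rewrite mem_iota xs IHr wr wL.
Qed.

(** The two blocks are disjoint: heads are at least [m] in the first and below [m] in the second. *)
Lemma uniq_continuations r s m : uniq (continuations r s m).
Proof.
elim: r s m => [|r IHr] s m //=.
rewrite cat_uniq uniq_decreasing_lists andbT; apply/andP; split.
  apply: allpairs_uniq_dep => [|x _|]; rewrite ?iota_uniq //.
  by move=> [x l] [y l'] _ _ /= [-> ->].
apply/hasPn => w; rewrite mem_decreasing_lists => /andP[_ mw].
apply/negP => /allpairsPdep[x [l [xs _ wE]]]; move: mw.
by rewrite wE /= => /andP[xm _]; move: xs; rewrite mem_iota leqNgt xm.
Qed.

(** This is the coefficient of z^(r+1) in the equation for H(s,m). *)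
Lemma size_continuationsS r s m :
  size (continuations r.+1 s m) =
  \sum_(m <= x < m + s) size (continuations r (m + s.+1 - x) x) + 'C(m, r.+1).
Proof.
rewrite /= size_cat size_decreasing_lists size_allpairs_dep sumnE big_map.
by rewrite /index_iota addKn.
Qed.

(** * Pattern avoidance for lists *)

Fixpoint avoids (w : seq nat) : bool :=
  if w is x :: w' then
    pairwise (fun y z => ~~ ((y < x) && (y <= z))) w' && avoids w'
  else true.

Lemma avoidsP w : reflect
  (forall i j k, i < j -> j < k -> k < size w ->
     ~~ ((nth 0 w j < nth 0 w i) && (nth 0 w j <= nth 0 w k)))
  (avoids w).
Proof.
elim: w => [|x w IHw] /=; first by apply: ReflectT => ? ? [].
apply: (iffP andP) => [[/(pairwiseP 0) xw /IHw ww]|ww].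
  case=> [|i] [|j] [|k] //= ij jk kw; last exact: ww.
  by apply: xw; rewrite // inE; lia.
split; last by apply/IHw => i j k ij jk kw; apply: (ww i.+1 j.+1 k.+1).
by apply/(pairwiseP 0) => j k _ kw jk; apply: (ww 0 j.+1 k.+1).
Qed.

Lemma avoids_decreasing m w : path gtn m w -> avoids (m :: w).
Proof.
elim: w m => //= x w IHw m /andP[xm xw]; have /= -> := IHw _ xw.
have: pairwise gtn (x :: w) by rewrite -(sorted_pairwise (rev_trans ltn_trans)).
rewrite andbT => /sub_pairwise; apply => y z /= yz.
by rewrite [y <= z]leqNgt yz andbF.
Qed.

(** An entry y right after [x] with y >= [x] would complete the pattern [m], [x], y. Hence y < [x],
    and the argument repeats from this new descent. *)
Lemma avoids_descent m x w : x < m -> avoids [:: m, x & w] = path gtn m (x :: w).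
Proof.
move=> xm; apply/idP/idP => [|/avoids_decreasing //].
elim: w m x xm => [|y w IHw] m x xm; first by rewrite /= xm.
move=> av; have := av => /= /andP[/andP[/andP[]]].
rewrite xm /= -ltnNge => yx _ _ _; have /= -> // := IHw x y yx _.
by case/andP: av.
Qed.

(** In a pattern starting at [m], the second entry is below [m <= x], so it comes after [x], and [x]
    can replace [m]. *)
Lemma avoids_ascent m x w : m <= x -> avoids [:: m, x & w] = avoids (x :: w).
Proof.
move=> mx; rewrite [LHS]/= -/(avoids (x :: w)).
apply/andP/idP => [[] //|av]; split=> //=.
rewrite [in X in all X]ltnNge mx /= all_predT /=.
case/andP: av => /sub_pairwise + _; apply=> y z.
by apply: contra => /andP[/leq_trans->].
Qed.

Lemma avoids0 w : avoids (0 :: w) = avoids w.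
Proof.
rewrite /=; suff -> : pairwise (fun y z => ~~ ((y < 0) && (y <= z))) w by [].
by elim: w => //= x w ->; rewrite andbT; apply/allP.
Qed.

Lemma continuesP s m w : reflect
  ((forall j, j < size w -> nth 0 w j < m + s + j) /\ avoids (m :: w))
  (continues s m w).
Proof.
elim: w s m => [|x w IHw] s m; first by apply: ReflectT.
rewrite [continues _ _ _]/=; case: (ltnP x m) => [xm|mx].
  rewrite avoids_descent //= xm /=.
  apply: (iffP idP) => [xw|[]] //; split=> // -[|j] jw /=.
    by rewrite addn0 ltn_addr.
  (* In the decreasing phase all entries stay below [x < m], so the bounds hold automatically. *)
  have /allP/(_ (nth 0 w j)) := order_path_min (rev_trans ltn_trans) xw.
  by rewrite mem_nth // => /(_ isT) /= wx; lia.
rewrite avoids_ascent // /= orbF.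
apply: (iffP andP) => [[xs /IHw[wb av]]|[wb av]].
  split=> // -[|j] jw /=; first by rewrite addn0.
  by have := wb _ jw; lia.
have /= xs := wb 0 isT; split; first by rewrite addn0 in xs.
apply/IHw; split=> // j jw; have /= := wb j.+1 jw; lia.
Qed.

(** For s = 1 and m = 0 the bound in [continuesP] says that entry j, counted from 0, is at most j;
    the leading 0 starts no pattern. *)
Lemma card_avoiders n : a n = size (continuations n 1 0).
Proof.
pose w (e : {ffun 'I_n -> 'I_n}) := [seq val (e i) | i <- enum 'I_n].
have sw e : size (w e) = n by rewrite size_map size_enum_ord.
have nw e (i : 'I_n) : nth 0 (w e) i = e i.
  by rewrite (nth_map i) ?size_enum_ord // nth_ord_enum.
have w_inj : injective w.
  by move=> e e' ee; apply/ffunP => i; apply/val_inj; rewrite /= -!nw ee.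
rewrite /a cardE -(size_map w); apply/perm_size/uniq_perm.
- by rewrite map_inj_uniq ?enum_uniq.
- exact: uniq_continuations.
move=> l; rewrite mem_continuations; apply/mapP/andP => [[e]|[/eqP ln /continuesP]].
  rewrite mem_enum !inE => /andP[/forallP eb ep] ->; rewrite sw eqxx.
  split=> //; apply/continuesP; split=> [j|].
    by rewrite sw => jn; rewrite (nw e (Ordinal jn)) ltnS; apply: (eb (Ordinal jn)).
  rewrite avoids0; apply/avoidsP => i j k ij jk; rewrite sw => kn.
  have jn := ltn_trans jk kn; have i_n := ltn_trans ij jn.
  apply: contra ep => av; apply/existsP; exists (Ordinal i_n).
  apply/existsP; exists (Ordinal jn); apply/existsP; exists (Ordinal kn).
  by rewrite -!nw ij jk.
rewrite avoids0 => -[lb /avoidsP lp].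
(* Here [insubd] returns the entry itself, which is at most [i] and hence below [n]. *)
pose e := [ffun i : 'I_n => insubd i (nth 0 l i)].
have eE (i : 'I_n) : e i = nth 0 l i :> nat.
  have li : nth 0 l i <= i by rewrite -ltnS lb ?ln.
  by rewrite ffunE val_insubd (leq_ltn_trans li).
exists e; last first.
  apply: (@eq_from_nth _ 0) => [|i]; rewrite ?sw // ln => i_n.
  by rewrite (nw e (Ordinal i_n)) eE.
rewrite mem_enum !inE; apply/andP; split.
  by apply/forallP => i; rewrite eE -ltnS lb ?ln.
apply/negP => /existsP[i /existsP[j /existsP[k /and4P[ij jk]]]].
rewrite !eE => eji ejk; have := lp i j k ij jk.
by rewrite ln ltn_ord eji ejk => /(_ isT).
Qed.

End Lists.

(** * Solving the recurrence by power series *)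

Section GeneratingFunctions.
Variable K : fieldType.
Implicit Types f g : fps K.

Lemma coefD f g n : coef (f + g) n = coef f n + coef g n.
Proof. by []. Qed.

Lemma coefN f n : coef (- f) n = - coef f n.
Proof. by []. Qed.

Lemma coefMn f k n : coef (f *+ k) n = coef f n *+ k.
Proof. by elim: k => // k IHk; rewrite !mulrS coefD IHk. Qed.

Lemma coef_sum I (s : seq I) (F : I -> fps K) n :
  coef (\sum_(i <- s) F i) n = \sum_(i <- s) coef (F i) n.
Proof. by apply: (big_morph (fun f => coef f n)). Qed.

Lemma coef0M f g : coef (f * g) 0 = coef f 0 * coef g 0.
Proof. by rewrite /= big_ord1. Qed.

Lemma coefXM f n : coef (fpsX K * f) n.+1 = coef f n.
Proof.
rewrite /= !big_ord_recl /= mul0r add0r mul1r subSS subn0 big1 ?addr0 // => i _.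
by rewrite mul0r.
Qed.

Lemma coef_oneDX m n : coef ((1 + fpsX K) ^+ m) n = 'C(m, n)%:R.
Proof.
elim: m n => [|m IHm] [|n] //; rewrite exprS mulrDl mul1r coefD.
  by rewrite IHm coef0M /= mul0r addr0 !bin0.
by rewrite coefXM !IHm binS natrD.
Qed.

Variable T : fps K.
Hypothesis TE : T = 1 + fpsX K + fpsX K * T ^+ 2.

Lemma continuation_series s m :
  (1 + fpsX K) ^+ m * (1 + T ^+ s) = (1 + fpsX K) ^+ m *+ 2 +
  fpsX K * \sum_(m <= x < m + s) (1 + fpsX K) ^+ x * (1 + T ^+ (m + s.+1 - x)).
Proof.
elim: s m => [|s IHs] m.
  by rewrite addn0 big_geq // mulr0 addr0 expr0 mulrDr mulr1.
(* Without the term x = m, the sum is the one for (s, m+1), which the induction hypothesis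
   eliminates. *)
rewrite big_ltn; last by rewrite -addSnnS leq_addr.
rewrite [fpsX K * (_ + _)]mulrDr addKn; have := IHs m.+1; rewrite !addSnnS.
move/(canLR (addKr _)) => <-.
(* This is the equation for [T] multiplied by [T ^+ s]. *)
have -> : T ^+ s.+1 = (1 + fpsX K) * T ^+ s + fpsX K * T ^+ s.+2.
  by rewrite exprS {1}TE !exprS; ring.
rewrite (exprS _ m); ring.
Qed.

(** The factor z before the sum lowers the degree, so the equation for H determines the coefficients
    by induction on [r]. *)
Lemma size_continuations r s m :
  (size (continuations r s m))%:R *+ 2 =
  coef ((1 + fpsX K) ^+ m * (1 + T ^+ s)) r.
Proof.
elim: r s m => [|r IHr] s m.
  by rewrite continuation_series coefD coefMn coef_oneDX coef0M mul0r addr0 bin0.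
rewrite continuation_series coefD coefMn coef_oneDX coefXM coef_sum.
rewrite size_continuationsS natrD natr_sum mulrnDl addrC; congr (_ + _).
by rewrite -sumrMnl; apply: eq_bigr => x _; rewrite IHr.
Qed.

End GeneratingFunctions.

Theorem theorem2p4 :
  let z : fps rat := fpsX rat in
  let A : fps rat := Fps (fun n : nat => (a n)%:R) in
  (tofrac A : {fraction (fps rat)}) =
  tofrac (1 + 2 * z - fps_sqrt (1 - 4 * z - 4 * z ^+ 2)) / tofrac (4 * z).
Proof.
move=> z A; set S := fps_sqrt _.
have c0 : coef (1 - 4 * z - 4 * z ^+ 2) 0 = 1.
  have -> : 1 - 4 * z - 4 * z ^+ 2 = 1 + z * (- 4 - 4 * z) by ring.
  by rewrite coefD coef0M mul0r.
have [S2 S0] : S ^+ 2 = 1 - 4 * z - 4 * z ^+ 2 /\ coef S 0 = 1.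
  by have [|/(_ erefl)] := fps_sqrtP S _ c0.
(* This is (1 - S)/(2z), a power series because [S] has constant term 1. *)
pose T : fps rat := Fps (fun n => - coef S n.+1 / 2).
have zT : 2 * z * T = 1 - S.
  have -> : 2 * z * T = z * (T *+ 2) by ring.
  apply: fpsP => -[|n]; first by rewrite coef0M mul0r coefD coefN S0 subrr.
  by rewrite coefXM coefMn coefD coefN add0r -mulr_natr divfK.
have z4 : 4 * z != 0.
  apply/eqP => /(congr1 (fun f => coef f 1)).
  by rewrite mulr_natl coefMn.
have TE : T = 1 + z + z * T ^+ 2.
  apply: (mulfI z4).
  have SE : S = 1 - 2 * z * T by rewrite zT; ring.
  (* Completing the square reduces the equation for [T] to the one for [S ^+ 2]. *)
  have -> : 4 * z * (1 + z + z * T ^+ 2) = 4 * z * T +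
      ((1 - 2 * z * T) ^+ 2 - (1 - 4 * z - 4 * z ^+ 2)) by ring.
  by rewrite -SE S2 subrr addr0.
have AE : 2 * A = 1 + T.
  apply: fpsP => n.
  rewrite mulr_natl coefMn /= card_avoiders (size_continuations TE).
  by rewrite expr0 mul1r expr1.
(* Clearing the denominator leaves an identity between power series. *)
suff -> : 1 + 2 * z - S = A * (4 * z).
  by rewrite tofracM mulfK // tofrac_eq0.
have -> : 1 + 2 * z - S = 2 * z * (1 + T) by rewrite mulrDr zT; ring.
rewrite -AE; ring.
Qed.
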